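(* Let $\tau$ be any ergodic measure-preserving transformation of a non-atomic probability space $(X,m)$. Then for any sequence of positive integers $(n_k)_{k\ge1}$ tending to infinity, there exists a function $f\in L^1(X)$ such that $$\sup_{M\ge1}\ \sup_{|c_k|\le1}\left\|\sum_{k=1}^M c_k\left(M_{n_{k+1}}f-M_{n_k}f\right)\right\|_1=\infty,$$ where the inner supremum is over all scalar sequences $(c_k)$ with $|c_k|\le 1$ for all $k$.
   Context: $M_nf(x)=\frac1n\sum_{k=1}^n f(\tau^kx)$ denotes the usual ergodic average. *)

(* Defs.v *)
From HB Require Import structures.
From mathcomp Require Import all_boot all_order all_algebra.
From mathcomp Require Import all_classical all_reals all_analysis.

Set Implicit Arguments.
Unset Strict Implicit.
Unset Printing Implicit Defensive.
Import Order.TTheory GRing.Theory Num.Theory.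
Import numFieldNormedType.Exports.
Local Open Scope classical_set_scope.
Local Open Scope ring_scope.

Definition non_atomic d (X : measurableType d) (R : realType)
    (m : {measure set X -> \bar R}) : Prop :=
  forall A : set X, measurable A -> (0 < m A)%E ->
    exists B : set X, [/\ measurable B, B `<=` A, (0 < m B)%E & (m B < m A)%E].

(* Invertibility of tau is not required. *)
Definition measure_preserving d (X : measurableType d) (R : realType)
    (m : {measure set X -> \bar R}) (tau : X -> X) : Prop :=
  measurable_fun [set: X] tau /\
  forall A : set X, measurable A -> m (tau @^-1` A) = m A.

Definition ergodic d (X : measurableType d) (R : realType)
    (m : probability X R) (tau : X -> X) : Prop :=
  forall A : set X, measurable A -> tau @^-1` A = A ->
    m A = 0%E \/ m A = 1%E.

Definition erg_avg (X : Type) (R : realType) (tau : X -> X) (n : nat)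
    (f : X -> R) (x : X) : R :=
  n%:R^-1 * \sum_(1 <= k < n.+1) f (iter k tau x).

(* Main.v *)
Require Import Defs.
From HB Require Import structures.
From mathcomp Require Import all_boot all_order all_algebra.
From mathcomp Require Import all_classical all_reals all_analysis.
From mathcomp Require Import measurable_realfun.
From mathcomp Require Import ring lra.

Set Implicit Arguments.
Unset Strict Implicit.
Unset Printing Implicit Defensive.
Import Order.TTheory GRing.Theory Num.Theory.
Import numFieldNormedType.Exports.
Local Open Scope classical_set_scope.
Local Open Scope ring_scope.

(** With coefficients [c] equal to 0 or 1 on suitable blocks of indices, the
    inner sum telescopes to
      [T_I f = \sum_(i < I) (M_(N (2i+1)) f - M_(N (2i)) f)]
    along any subsequence [N] of [n], which may be taken to grow by factors of
    at least 8. Since averages contract the [L^1] norm, [T_I] has norm at most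
    [2 I]. A fixed fraction of this bound is attained. Let [A] be the base of
    a tower, i.e. a set of positive measure disjoint from many of its
    preimages, and let [f] be its normalized indicator. On the [j]-th preimage
    of [A] the average [M_n f] is [1/n] if [j <= n] and [0] otherwise, up to
    the factor [1/m(A)]. Thus [T_I f] is a copy of a combination of uniform
    distributions on the intervals [1..N i]. The largest part of [1..N i] lies
    beyond [N (i-1)], so these distributions are almost disjoint and the norm
    of their alternating sum is at least [3/2 I] ([lacunary_averages_spread],
    [Lnorm1_block_sum_bump]).

    Towers of every height exist because a non-atomic space has sets [E] of
    arbitrarily small positive measure, and the points which first reach [E]
    at time [L] form the base of a tower of height [L]; by ergodicity such
    points have positive measure when the first [L] preimages of [E] do not
    fill the space ([ergodic_tower]).

    Unboundedness of the norms of [T_I] gives a single [f] by the gliding hump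
    method ([gliding_hump]): [f] is a sum of terms [8^-j g_j], where [g_j]
    realizes three quarters of the norm bound for the [j]-th operator [T_I],
    [I = 16^j], and is included in the sum only if the partial sum before it
    does not already have a large image. *)

(** * Towers for ergodic transformations *)

Section Towers.
Context {d : measure_display} {X : measurableType d} {R : realType}.
Variables (m : probability X R) (tau : X -> X).

Lemma measure_preserving_iter k :
  measure_preserving m tau -> measure_preserving m (iter k tau).
Proof.
move=> [mtau ptau]; elim: k => [|k [mk pk]]; first by split=> //; exact: measurable_id.
split=> [|A mA]; first exact: measurableT_comp mtau mk.
rewrite (_ : _ @^-1` A = iter k tau @^-1` (tau @^-1` A))//.
by rewrite pk ?ptau// -[_ @^-1` _]setTI; exact: mtau.
Qed.

Lemma measurable_preimage_iter k (A : set X) :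
  measure_preserving m tau -> measurable A -> measurable (iter k tau @^-1` A).
Proof.
move=> mp mA; have [mk _] := measure_preserving_iter k mp.
by rewrite -[_ @^-1` _]setTI; exact: mk.
Qed.

(** Non-atomicity splits [A] into two parts of positive measure, and the smaller
    one has at most half the measure. *)
Lemma non_atomic_halve (A : set X) : non_atomic m -> measurable A ->
  (0 < m A)%E ->
  exists B, [/\ measurable B, (0 < m B)%E & (m B + m B <= m A)%E].
Proof.
move=> na mA A0; have [B [mB BA B0 ltBA]] := na _ mA A0.
have fA : m A \is a fin_num by exact: fin_num_measure.
have fB : m B \is a fin_num by exact: fin_num_measure.
have mAB : measurable (A `\` B) by exact: measurableD.
have eAB : (m (A `\` B) = m A - m B)%E.
  rewrite measureD//; first by rewrite (setIidr BA).
  by rewrite ltey_eq fA.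
have [le|gt] := leP (m B + m B)%E (m A); first by exists B.
exists (A `\` B); rewrite eAB; split=> //; first by rewrite sube_gt0.
by move: gt; rewrite -(fineK fA) -(fineK fB) -!EFinB -!EFinD lte_fin lee_fin; lra.
Qed.

(** Halving [N] times gives measure at most [2 ^- N], and [N < 2 ^ N]. *)
Lemma non_atomic_small (N : nat) : non_atomic m ->
  exists E, [/\ measurable E, (0 < m E)%E & (N%:R%:E * m E < 1)%E].
Proof.
move=> na.
have [E [mE E0 E1]] : exists E, [/\ measurable E, (0 < m E)%E &
    ((2 ^ N)%:R%:E * m E <= 1)%E].
  elim: N => [|N [E [mE E0 E1]]].
    by exists setT; rewrite probability_setT mul1e.
  have [B [mB B0 B1]] := non_atomic_halve na mE E0.
  exists B; split=> //; apply: le_trans E1; apply: le_trans; last first.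
    by apply: lee_wpmul2l B1; rewrite lee_fin.
  have fB : m B \is a fin_num by exact: fin_num_measure.
  by rewrite -(fineK fB) -EFinD -!EFinM lee_fin expnS natrM; lra.
exists E; split=> //; apply: lt_le_trans E1.
have fE : m E \is a fin_num by exact: fin_num_measure.
move: E0; rewrite -(fineK fE) -!EFinM !lte_fin => E0.
by rewrite ltr_pM2r// ltr_nat ltn_expl.
Qed.

(** Take [E] with [N * m E < 1] and let [A] be the set of points that reach [E]
    for the first time at time [N].  If [x] and [tau^i x] both were in [A] with
    [0 < i <= N], then [tau^i x] would reach [E] at time [N - i < N].  If [A]
    were null, then so would be the sets of points with later first hitting
    times, hence almost all the points that ever reach [E] would do so before
    time [N]; these have measure less than 1, which contradicts ergodicity. *)
Lemma ergodic_tower (N : nat) : non_atomic m -> measure_preserving m tau ->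
  ergodic m tau ->
  exists A, [/\ measurable A, (0 < m A)%E &
    forall x i, A x -> (0 < i <= N)%N -> ~ A (iter i tau x)].
Proof.
move=> na mp erg; have [E [mE E0 smallE]] := non_atomic_small N na.
pose S n := iter n tau @^-1` E.
have mS n : measurable (S n) by exact: measurable_preimage_iter.
(* [H n] is the set of points whose first hitting time of [E] is [n]. *)
pose H n := S n `\` \bigcup_(i in `I_n) S i.
have mH n : measurable (H n).
  by apply: measurableD => //; apply: bigcup_measurable => ? _.
exists (H N); split => //; last first.
  move=> x i [SNx nSx] /andP[i0 iN] [_ []].
  exists (N - i)%N; first by rewrite /= -subn_gt0 subKn.
  by rewrite /S /= -iterD subnK.
rewrite measure_gt0; apply/negP => /eqP HN0.
have H0 n : m (H (n + N)%N) = 0%E.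
  elim: n => // n IHn; apply/eqP; rewrite -measure_le0 -[leRHS]IHn.
  have mHn := measurable_preimage_iter 1 mp (mH (n + N)%N).
  have [_ pm] := mp; rewrite -pm//; apply: le_measure; rewrite ?inE//.
  move=> x [Sx nSx]; split; first by move: Sx; rewrite /S /= -iterSr.
  move=> [i lti Si]; apply: nSx; exists i.+1 => //.
  by move: Si; rewrite /S /= -iterSr.
pose U := \bigcup_n S n.
have mU : measurable U by exact: bigcup_measurable.
have UE : U `<=` \bigcup_(i in `I_N) S i `|` \bigcup_n H (n + N)%N.
  move=> x [n _ Snx].
  have [i Si imin] := @ex_minnP (fun i => `[< S i x >]) (ex_intro _ n (asboolT Snx)).
  have [iN|Ni] := ltnP i N; first by left; exists i => //; exact/asboolP.
  right; exists (i - N)%N => //; rewrite subnK//; split; first exact/asboolP.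
  by move=> [j ji Sj]; move: (imin j (asboolT Sj)); rewrite leqNgt ji.
have U1 : (m U < 1)%E.
  apply: le_lt_trans smallE.
  have mS1 : measurable (\bigcup_(i in `I_N) S i) by apply: bigcup_measurable.
  have mH1 : measurable (\bigcup_n H (n + N)%N) by apply: bigcup_measurable.
  have H10 : m (\bigcup_n H (n + N)%N) = 0%E.
    apply: measure_negligible => //; apply: negligible_bigcup => n.
    apply/negligibleP; [exact: mH|exact: H0].
  apply: (@le_trans _ _ (m (\bigcup_(i in `I_N) S i `|` \bigcup_n H (n + N)%N))).
    by apply: le_measure => //; rewrite inE//; exact: measurableU.
  apply: le_trans (measureU2 _ mS1 mH1) _; rewrite [X in (_ + X)%E]H10 adde0.
  rewrite bigcup_mkord; apply: (@le_trans _ _ (\sum_(i < N) m (S i))%E).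
    exact: Boole_inequality.
  have fE : m E \is a fin_num by exact: fin_num_measure.
  rewrite (eq_bigr (fun=> (fine (m E))%:E)) => [|i _].
    by rewrite sumEFin sumr_const card_ord -[in leRHS](fineK fE) -EFinM mulr_natl.
  by rewrite fineK//; exact: (measure_preserving_iter i mp).2.
have U0 : (0 < m U)%E.
  apply: lt_le_trans E0 _; apply: le_measure; rewrite ?inE//.
  by move=> x Ex; exists 0%N.
(* [U] contains its preimage but need not equal it; the decreasing intersection
   of its preimages is strictly invariant and has the same measure. *)
pose F k := iter k tau @^-1` U.
have mF k : measurable (F k) by exact: measurable_preimage_iter.
have stepU x : U (tau x) -> U x.
  by move=> [n _ Sn]; exists n.+1 => //; move: Sn; rewrite /S /= -iterSr.
pose V := \bigcap_k F k.
have mV : measurable V by exact: bigcapT_measurable.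
have VU : m V = m U.
  have cF : m \o F @ \oo --> m V.
    apply: nonincreasing_cvg_mu => //.
      by rewrite (le_lt_trans (probability_le1 _ _))// ltry.
    move=> i j ij; apply/subsetPset => x; rewrite /F /= -(subnK ij).
    by elim: (j - i)%N => // k IH /stepU/IH.
  have -> : m V = limn (m \o F) by apply/esym/cvg_lim.
  rewrite (_ : m \o F = cst (m U)) ?lim_cst//.
  by apply/funext => k /=; exact: (measure_preserving_iter k mp).2.
have [V0|V1] : m V = 0%E \/ m V = 1%E.
  apply: erg => //; apply/seteqP; split=> x Vx k _.
    case: k => [|k]; first by apply/stepU; exact: (Vx 0%N).
    by have := Vx k I; rewrite /F /= -iterSr.
  by have := Vx k.+1 I; rewrite /F /= -iterS iterSr.
- by rewrite -VU V0 ltxx in U0.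
- by rewrite -VU V1 ltxx in U1.
Qed.

End Towers.

(** * Alternating sums of uniform distributions on intervals *)

Section Blocks.
Variable R : realFieldType.

(** The coefficients are 1 on the blocks from [k (2i)] to [k (2i+1)], where the
    sum telescopes, and 0 elsewhere. *)
Lemma block_selection (k : nat -> nat) (I : nat) :
  (0 < k 0)%N -> (forall i, (k i < k i.+1)%N) ->
  exists c : nat -> R, (forall j, `|c j| <= 1) /\
    forall u : nat -> R, \sum_(1 <= j < k I.*2) c j * (u j.+1 - u j) =
      \sum_(i < I) (u (k i.*2.+1) - u (k i.*2)).
Proof.
move=> k0 kS; elim: I => [|I [c [c1 cE]]].
  exists (fun=> 0); split=> [j|u]; first by rewrite normr0.
  by rewrite big_ord0 big1// => j _; rewrite mul0r.
have kpos i : (0 < k i)%N by elim: i => // i IH; apply: leq_ltn_trans (kS i).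
pose a := k I.*2; pose b := k I.*2.+1.
have ab : (a <= b)%N by exact/ltnW/kS.
have bd : (b <= k I.+1.*2)%N by exact/ltnW/kS.
exists (fun j => if (j < a)%N then c j else (j < b)%N%:R); split=> [j|u].
  by case: ifP => // _; case: (j < b)%N; rewrite ?normr1 ?normr0.
rewrite big_ord_recr/= -cE (big_cat_nat (kpos I.*2 : (1 <= a)%N) (leq_trans ab bd))/=.
congr (_ + _).
  by rewrite !big_nat; apply: eq_bigr => j /andP[_ ja]; rewrite ja.
rewrite (big_cat_nat (n := b))//= -[RHS]addr0; congr (_ + _).
  rewrite -telescope_sumr// !big_nat; apply: eq_bigr => j /andP[aj jb].
  by rewrite ltnNge aj /= jb mul1r.
rewrite big_nat big1// => j /andP[bj _].
by rewrite !ltnNge bj (leq_trans ab bj) mul0r.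
Qed.

(** [phi] is the constant [(-1)^(i+1)] on the interval from [N (i-1)] to [N i],
    which makes up at least 7/8 of the interval from 1 to [N i]; the remaining
    part changes the average by at most 2/8.  This [phi] is the test function
    that detects the norm in [lacunary_averages_spread]. *)
Lemma alternating_averages (N : nat -> nat) (I : nat) :
  (forall i, (8 * N i <= N i.+1)%N) ->
  exists phi : nat -> R, (forall j, `|phi j| <= 1) /\
    forall i, (i <= I)%N ->
      3 / 4 * (N i)%:R <= (-1) ^+ i.+1 * \sum_(1 <= j < (N i).+1) phi j.
Proof.
move=> N8; elim: I => [|I [phi [phi1 phiE]]].
  exists (fun=> -1); split=> [j|i]; first by rewrite normrN normr1.
  rewrite leqn0 => /eqP->; rewrite sumr_const_nat subSS subn0 expr1.
  by rewrite mulN1r mulNrn opprK; have := ler0n R (N 0); lra.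
have N8R : 8 * (N I)%:R <= (N I.+1)%:R :> R by rewrite -natrM ler_nat.
have leNI i : (i <= I)%N -> (N i <= N I)%N.
  move=> iI; rewrite -(subnKC iI); elim: (I - i)%N => [|n IH]; first by rewrite addn0.
  by rewrite addnS; apply: leq_trans IH _; apply: leq_trans (N8 _); rewrite leq_pmull.
exists (fun j => if (j <= N I)%N then phi j else (-1) ^+ I.+2); split=> [j|i].
  by case: ifP => // _; rewrite normrX normrN1 expr1n.
have lowE n : (n <= N I)%N -> \sum_(1 <= j < n.+1)
    (if (j <= N I)%N then phi j else (-1) ^+ I.+2) = \sum_(1 <= j < n.+1) phi j.
  move=> nI; rewrite !big_nat; apply: eq_bigr => j /andP[_].
  by rewrite ltnS => jn; rewrite (leq_trans jn nI).
rewrite leq_eqVlt => /predU1P[->|]; last first.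
  by rewrite ltnS => iI; rewrite lowE ?leNI//; exact: phiE.
have NII : (N I <= N I.+1)%N by apply: leq_trans (N8 I); rewrite leq_pmull.
rewrite (big_cat_nat (n := (N I).+1))//= lowE//.
rewrite [X in _ + X](_ : _ = (-1) ^+ I.+2 * ((N I.+1)%:R - (N I)%:R)); last first.
  rewrite -natrB// mulr_natr -subSS -sumr_const_nat !big_nat.
  by apply: eq_bigr => j /andP[+ _]; rewrite ltnNge => /negbTE ->.
rewrite mulrDr mulrA -expr2 sqrr_sign mul1r.
have : `|(-1) ^+ I.+2 * \sum_(1 <= j < (N I).+1) phi j| <= (N I)%:R.
  rewrite normrM normrX normrN1 expr1n mul1r (le_trans (ler_norm_sum _ _ _))//.
  apply: le_trans (ler_sum _ (fun j _ => phi1 j)) _.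
  by rewrite sumr_const_nat subSS subn0.
rewrite ler_norml => /andP[+ _].
move: N8R; lra.
Qed.

(** The [l^1] norm of the alternating sum of the uniform distributions on the
    intervals [1..N i].  Pairing with the function [phi] of
    [alternating_averages], each of the [I] differences contributes at least
    [3/4 + 3/4]. *)
Lemma lacunary_averages_spread (N : nat -> nat) (I L : nat) :
  (0 < N 0)%N -> (forall i, (8 * N i <= N i.+1)%N) ->
  (forall i, (i < I.*2)%N -> (N i <= L)%N) ->
  3 / 2 * I%:R <= \sum_(1 <= j < L.+1)
    `| \sum_(i < I) ((j <= N i.*2.+1)%N%:R / (N i.*2.+1)%:R
                     - (j <= N i.*2)%N%:R / (N i.*2)%:R) | :> R.
Proof.
move=> N0 N8 NL; have [phi [phi1 phiE]] := alternating_averages I.*2 N8.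
have Npos i : (0 < N i)%N.
  by elim: i => // i IH; apply: leq_trans (N8 i); rewrite muln_gt0.
pose h n j : R := (j <= n)%N%:R / n%:R.
have avg n : (n <= L)%N -> \sum_(1 <= j < L.+1) phi j * h n j =
    (\sum_(1 <= j < n.+1) phi j) / n%:R.
  move=> nL; rewrite (big_cat_nat (n := n.+1))//= [X in _ + X]big1_seq ?addr0.
    rewrite mulr_suml !big_nat; apply: eq_bigr => j /andP[_].
    by rewrite ltnS /h => ->; rewrite mul1r.
  move=> j /=; rewrite mem_index_iota => /andP[+ _].
  by rewrite /h ltnNge => /negbTE->; rewrite mul0r mulr0.
apply: (@le_trans _ _ (\sum_(1 <= j < L.+1)
    phi j * \sum_(i < I) (h (N i.*2.+1) j - h (N i.*2) j))); last first.
  apply: ler_sum => j _; apply: le_trans (ler_norm _) _; rewrite normrM.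
  by rewrite ler_piMl.
under eq_bigr do rewrite mulr_sumr.
rewrite exchange_big/= mulr_natr -[I in leLHS]card_ord -sumr_const.
apply: ler_sum => i _.
have i2 : (i.*2.+1 < I.*2)%N by rewrite -doubleS leq_double.
under eq_bigr do rewrite mulrBr.
rewrite sumrB !avg ?NL//; last exact: ltnW.
have := phiE _ (ltnW i2); have := phiE _ (ltnW (ltnW i2)).
have e2 : (-1) ^+ i.*2 = 1 :> R by rewrite -signr_odd odd_double.
rewrite !exprS e2 !mulr1 !mulN1r opprK mul1r.
have pos n : 0 < (N n)%:R :> R by rewrite ltr0n.
move=> A1 A2.
have B1 : 3 / 4 <= (\sum_(1 <= j < (N i.*2.+1).+1) phi j) / (N i.*2.+1)%:R.
  by rewrite ler_pdivlMr.
have B2 : 3 / 4 <= - ((\sum_(1 <= j < (N i.*2).+1) phi j) / (N i.*2)%:R).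
  by rewrite -mulNr ler_pdivlMr.
by rewrite (_ : 3 / 2 = 3 / 4 + 3 / 4); [exact: lerD|field].
Qed.

End Blocks.

(** * Ergodic averages in L1 *)

Section Averages.
Context {d : measure_display} {X : measurableType d} {R : realType}.
Variables (m : probability X R) (tau : X -> X).
Hypothesis tau_mp : measure_preserving m tau.
Implicit Types f g : X -> R.

Local Notation norm1 f := ('N[m]_1[EFin \o f])%E.

Lemma measurable_comp_iter k f : measurable_fun setT f ->
  measurable_fun setT (fun x => f (iter k tau x)).
Proof.
by move=> mf; apply: (measurableT_comp mf); have [] := measure_preserving_iter k tau_mp.
Qed.

Lemma Lnorm1_comp_iter k f : measurable_fun setT f ->
  norm1 (fun x => f (iter k tau x)) = norm1 f.
Proof.
move=> mf; have [mk pk] := measure_preserving_iter k tau_mp.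
have mF : measurable_fun setT (abse \o (EFin \o f)).
  by apply: measurableT_comp => //; exact/measurable_EFinP.
rewrite !Lnorm1 -[LHS](ge0_integral_pushforward mk _ measurableT mF)//=.
by apply: eq_measure_integral => // A mA _; exact: pk.
Qed.

Lemma Lnorm1D f g : measurable_fun setT f -> measurable_fun setT g ->
  (norm1 (fun x => (f x + g x)%R) <= norm1 f + norm1 g)%E.
Proof. by move=> mf mg; exact: minkowski_EFin. Qed.

Lemma Lnorm1_sum (I : Type) (s : seq I) (F : I -> X -> R) :
  (forall i, measurable_fun setT (F i)) ->
  (norm1 (fun x => (\sum_(i <- s) F i x)%R) <= \sum_(i <- s) norm1 (F i))%E.
Proof.
move=> mF; elim: s => [|i s IH].
  rewrite big_nil (_ : EFin \o _ = cst 0%E) ?Lnorm0//.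
  by apply/funext => x /=; rewrite big_nil.
rewrite big_cons (_ : (fun x => _) = fun x => F i x + \sum_(j <- s) F j x).
  apply: le_trans (Lnorm1D (mF i) _) _; first exact: measurable_sum.
  exact: leeD2l.
by apply/funext => x; rewrite big_cons.
Qed.

Lemma Lnorm1Z (a : R) f : measurable_fun setT f ->
  norm1 (fun x => (a * f x)%R) = (`|a|%:E * norm1 f)%E.
Proof.
move=> mf; rewrite !Lnorm1 -ge0_integralZl//; last first.
  by apply: measurableT_comp => //; exact/measurable_EFinP.
by apply: eq_integral => x _ /=; rewrite normrM EFinM.
Qed.

Lemma measurable_erg_avg n f : measurable_fun setT f ->
  measurable_fun setT (erg_avg tau n f).
Proof.
move=> mf; apply: measurable_funM; first exact: measurable_cst.
by apply: measurable_sum => k; exact: measurable_comp_iter.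
Qed.

Lemma Lnorm1_erg_avg n f : (0 < n)%N -> measurable_fun setT f ->
  (norm1 (erg_avg tau n f) <= norm1 f)%E.
Proof.
move=> n0 mf; have mk k := measurable_comp_iter k mf.
rewrite Lnorm1Z; last exact: measurable_sum.
apply: le_trans (lee_wpmul2l _ (Lnorm1_sum _ mk)) _; first by rewrite lee_fin.
under eq_bigr do rewrite Lnorm1_comp_iter//.
rewrite ger0_norm ?invr_ge0//; case: (norm1 f) (Lnorm_ge0 m 1 (EFin \o f)) => //= [r r0|_].
  rewrite sumEFin sumr_const_nat subSS subn0 -EFinM lee_fin.
  by rewrite -[r *+ n]mulr_natl mulrA mulVf ?mul1r// pnatr_eq0 -lt0n.
exact: leey.
Qed.

(** What the sum in the theorem becomes by telescoping, for the coefficients of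
    [block_selection]. *)
Definition block_sum (N : nat -> nat) (I : nat) f (x : X) : R :=
  \sum_(i < I) (erg_avg tau (N i.*2.+1) f x - erg_avg tau (N i.*2) f x).

Lemma erg_avg_lin n a b f g x :
  erg_avg tau n (fun y => a * f y + b * g y) x =
  a * erg_avg tau n f x + b * erg_avg tau n g x.
Proof.
by rewrite /erg_avg big_split/= -!mulr_sumr mulrDr (mulrCA a) (mulrCA b).
Qed.

Lemma block_sum_lin N I a b f g x :
  block_sum N I (fun y => a * f y + b * g y) x =
  a * block_sum N I f x + b * block_sum N I g x.
Proof.
rewrite /block_sum !mulr_sumr -big_split/=; apply: eq_bigr => i _.
by rewrite !erg_avg_lin; ring.
Qed.

Lemma measurable_block_sum N I f : measurable_fun setT f ->
  measurable_fun setT (block_sum N I f).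
Proof.
move=> mf; apply: measurable_sum => i.
by apply: measurable_funB; exact: measurable_erg_avg.
Qed.

Lemma Lnorm1_block_sum N I f : (forall i, (0 < N i)%N) ->
  measurable_fun setT f ->
  (norm1 (block_sum N I f) <= (2 * I%:R)%:E * norm1 f)%E.
Proof.
move=> N0 mf; have mN i := measurable_erg_avg (N i) mf.
have mNN i j : measurable_fun setT
    (fun x => erg_avg tau (N i) f x - erg_avg tau (N j) f x).
  exact: measurable_funB.
apply: le_trans (Lnorm1_sum _ (fun i : 'I_I => mNN i.*2.+1 i.*2)) _.
apply: (@le_trans _ _ (\sum_(i < I) (norm1 f + norm1 f))%E).
  apply: lee_sum => i _.
  have := leeD (Lnorm1_erg_avg (N0 i.*2.+1) mf) (Lnorm1_erg_avg (N0 i.*2) mf).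
  apply: le_trans.
  apply: le_trans (Lnorm1D (mN _) (measurableT_comp (@oppr_measurable _ _) (mN _))) _.
  apply: leeD => //; rewrite !Lnorm1 le_eqVlt; apply/orP; left; apply/eqP.
  by apply: eq_integral => x _ /=; rewrite normrN.
case: (norm1 f) (Lnorm_ge0 m 1 (EFin \o f)) => //= [r r0|_].
  under eq_bigr do rewrite -EFinD.
  rewrite sumEFin sumr_const card_ord -EFinM lee_fin -mulr_natl.
  by rewrite le_eqVlt; apply/orP; left; apply/eqP; ring.
case: I => [|I]; first by rewrite big_ord0 mulr0 mul0e.
by rewrite gt0_muley ?leey// lte_fin mulr_gt0.
Qed.

End Averages.

(** * Averages of the indicator of a tower base *)

Section Spread.
Context {d : measure_display} {X : measurableType d} {R : realType}.
Variables (m : probability X R) (tau : X -> X).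
Hypothesis tau_mp : measure_preserving m tau.

Local Notation norm1 f := ('N[m]_1[EFin \o f])%E.

Definition bump (A : set X) (x : X) : R := (fine (m A))^-1 * \1_A x.

Lemma measurable_bump A : measurable A -> measurable_fun setT (bump A).
Proof.
by move=> mA; apply: measurable_funM; [exact: measurable_cst|exact: measurable_indic].
Qed.

Lemma Lnorm1_bump A : measurable A -> (0 < m A)%E -> norm1 (bump A) = 1%E.
Proof.
move=> mA A0; have fA : m A \is a fin_num by exact: fin_num_measure.
have p0 : 0 < fine (m A) by rewrite -lte_fin fineK.
rewrite Lnorm1Z; last exact: measurable_indic.
have -> : norm1 (\1_A : X -> R) = m A.
  rewrite Lnorm1 -[in RHS](setIT A) -integral_indic//.
  by apply: eq_integral => x _ /=; rewrite ger0_norm.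
by rewrite ger0_norm ?invr_ge0 ?ltW// -{2}(fineK fA) -EFinM mulVf ?gt_eqF.
Qed.

(** The orbit of a point of the [j]-th preimage of the tower base meets the base
    at time [j] and at no other time up to [L]. *)
Lemma erg_avg_bump A (L n j : nat) x :
  (forall y i, A y -> (0 < i <= L)%N -> ~ A (iter i tau y)) ->
  (0 < j <= L)%N -> (n <= L)%N -> A (iter j tau x) ->
  erg_avg tau n (bump A) x = (fine (m A))^-1 * ((j <= n)%N%:R / n%:R).
Proof.
move=> tower /andP[j0 jL] nL Aj.
have only_j k : (k <= L)%N -> k != j -> \1_A (iter k tau x) = 0 :> R.
  move=> kL kj; rewrite indicE memNset// => Ak.
  have [lt_kj|lt_jk|eq_kj] := ltngtP k j; last by rewrite eq_kj eqxx in kj.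
    apply: (tower _ (j - k)%N Ak); last by rewrite -iterD subnK// ltnW.
    by rewrite subn_gt0 lt_kj (leq_trans (leq_subr _ _)).
  apply: (tower _ (k - j)%N Aj); last by rewrite -iterD subnK// ltnW.
  by rewrite subn_gt0 lt_jk (leq_trans (leq_subr _ _)).
rewrite /erg_avg /bump -mulr_sumr mulrCA [_ / n%:R]mulrC; congr (_ * (_ * _)).
have [jn|nj] := leqP j n.
  rewrite (bigD1_seq j) ?iota_uniq ?mem_index_iota ?j0//=.
  rewrite indicE mem_set// big_seq_cond big1 ?addr0// => k.
  rewrite mem_index_iota ltnS => /andP[/andP[_ kn] kj].
  by rewrite only_j// (leq_trans kn).
rewrite big_nat big1// => k /andP[_]; rewrite ltnS => kn.
by rewrite only_j ?(leq_trans kn)// neq_ltn (leq_ltn_trans kn nj).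
Qed.

(** On the [j]-th preimage of [A], which has the measure of [A], the function is
    constant with value [a j / m A].  These preimages are disjoint, so the norm
    is at least the sum of the [`|a j|]. *)
Lemma Lnorm1_block_sum_bump A (N : nat -> nat) (I L : nat) :
  measurable A -> (0 < m A)%E ->
  (forall y i, A y -> (0 < i <= L)%N -> ~ A (iter i tau y)) ->
  (0 < N 0)%N -> (forall i, (8 * N i <= N i.+1)%N) ->
  (forall i, (i < I.*2)%N -> (N i <= L)%N) ->
  ((3 / 2 * I%:R)%:E <= norm1 (block_sum tau N I (bump A)))%E.
Proof.
move=> mA A0 tower N0 N8 NL.
have fA : m A \is a fin_num by exact: fin_num_measure.
have p0 : 0 < fine (m A) by rewrite -lte_fin fineK.
pose S j := iter j tau @^-1` A.
have mS j : measurable (S j) by exact: (measurable_preimage_iter _ tau_mp).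
pose a j : R := \sum_(i < I) ((j <= N i.*2.+1)%N%:R / (N i.*2.+1)%:R
                     - (j <= N i.*2)%N%:R / (N i.*2)%:R).
have block_a j x : (0 < j <= L)%N -> S j x ->
    block_sum tau N I (bump A) x = (fine (m A))^-1 * a j.
  move=> jL Sx; rewrite mulr_sumr; apply: eq_bigr => i _.
  have i2 : (i.*2.+1 < I.*2)%N by rewrite -doubleS leq_double.
  rewrite (erg_avg_bump tower jL (NL _ i2) Sx).
  by rewrite (erg_avg_bump tower jL (NL _ (ltnW i2)) Sx) -mulrBr.
have mT := measurable_block_sum tau_mp N I (measurable_bump mA).
have mT1 D : measurable_fun D (fun x => `|(EFin \o block_sum tau N I (bump A)) x|%E).
  apply: (measurable_funS measurableT) => //.
  by apply: measurableT_comp => //; exact/measurable_EFinP.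
have triv : trivIset [set` index_iota 1 L.+1] S.
  move=> i j /=; rewrite !mem_index_iota !ltnS => /andP[_ iL] /andP[_ jL] [x [Si Sj]].
  wlog lt_ij : i j iL jL Si Sj / (i < j)%N.
    by move=> H; have [/H->|/H->|] := ltngtP i j.
  exfalso; apply: (tower _ (j - i)%N Si).
    by rewrite subn_gt0 lt_ij (leq_trans (leq_subr _ _)).
  by rewrite -iterD subnK// ltnW.
apply: le_trans (_ : ((\sum_(1 <= j < L.+1) `|a j|)%:E <= _)%E).
  by rewrite lee_fin; exact: lacunary_averages_spread.
pose D := \big[setU/set0]_(j <- index_iota 1 L.+1) S j.
have mD : measurable D by exact: bigsetU_measurable.
rewrite Lnorm1; apply: (@le_trans _ _
    (\int[m]_(x in D) `|(EFin \o block_sum tau N I (bump A)) x|)%E); last first.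
  exact: ge0_subset_integral.
rewrite ge0_integral_bigsetU//; last exact: iota_uniq.
rewrite -sumEFin !big_seq; apply: lee_sum => j; rewrite mem_index_iota ltnS => jL.
rewrite (eq_integral (fun=> (`|(fine (m A))^-1 * a j|)%:E)); last first.
  by move=> x; rewrite inE => Sx /=; rewrite (block_a j).
rewrite integral_cst//= (measure_preserving_iter j tau_mp).2//.
rewrite -[X in (_ * X)%E](fineK fA) -EFinM lee_fin normrM.
by rewrite [`|_^-1|]gtr0_norm ?invr_gt0// mulrAC mulVf ?mul1r// gt_eqF.
Qed.

End Spread.

(** * The gliding hump method *)

Section GlidingHump.
Context {d : measure_display} {X : measurableType d} {R : realType}.
Variable m : probability X R.

Local Notation norm1 f := ('N[m]_1[EFin \o f])%E.

Let pow8_ge0 n : 0 <= (8^-1 : R) ^+ n.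
Proof. by rewrite exprn_ge0// invr_ge0 ler0n. Qed.

Lemma geometric8_le (n N : nat) :
  \sum_(n <= k < N) (8^-1 : R) ^+ k <= 8 / 7 * 8^-1 ^+ n.
Proof.
have [Nn|nN] := leqP N n.
  by rewrite big_geq// mulr_ge0// divr_ge0.
rewrite (eq_big_nat _ _ 
  (F2 := fun k => - (8 / 7 * 8^-1 ^+ k.+1) - - (8 / 7 * 8^-1 ^+ k))).
  rewrite telescope_sumr ?(ltnW nN)// opprK.
  by have := pow8_ge0 N; lra.
by move=> k _; rewrite exprS; lra.
Qed.

(** An absolutely convergent series in [L^1] converges in [L^1], for nonnegative
    terms and with an explicit rate. *)
Lemma L1_series_remainder (u : nat -> X -> R) :
  (forall k x, 0 <= u k x) -> (forall k, measurable_fun setT (u k)) ->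
  (forall k, (norm1 (u k) <= (8^-1 ^+ k)%:E)%E) ->
  exists f : X -> R, measurable_fun setT f /\
    forall n, (norm1 (fun x => (\sum_(0 <= k < n) u k x - f x)%R)
               <= (8 / 7 * 8^-1 ^+ n)%:E)%E.
Proof.
move=> u0 mu normu.
have mU k : measurable_fun setT (EFin \o u k) by exact/measurable_EFinP.
have U0 k x : (0 <= (EFin \o u k) x)%E by rewrite lee_fin.
pose F x := (\sum_(0 <= k <oo) (u k x)%:E)%E.
have mF : measurable_fun setT F.
  by apply: (@ge0_emeasurable_sum _ _ _ _ (fun k => EFin \o u k) xpredT).
have mfine : measurable_fun setT (fine \o F).
  by apply: measurableT_comp => //; exact: fine_measurable.
exists (fine \o F); split=> // n.
pose r x := (\sum_(0 <= k <oo) (u (k + n)%N x)%:E)%E.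
have FE x : F x = ((\sum_(0 <= k < n) u k x)%:E + r x)%E.
  rewrite /F (nneseries_split 0 n) => [|k _]; last by rewrite lee_fin.
  rewrite add0n sumEFin; congr (_ + _)%E; rewrite /r.
  by rewrite -(@nneseries_addn _ (fun k => (u k x)%:E))// => k; exact: U0.
have r0 x : (0 <= r x)%E by apply: nneseries_ge0 => k _ _; rewrite lee_fin.
have mr : measurable_fun setT r.
  by apply: (@ge0_emeasurable_sum _ _ _ _ (fun k => EFin \o u (k + n)%N) xpredT).
(* Where the series diverges, [fine] gives 0 and the remainder is infinite, so
   that the bound holds at every point. *)
have le_r x : (`|\sum_(0 <= k < n) u k x - fine (F x)|%:E <= r x)%E.
  rewrite FE; case: (r x) (r0 x) => //= [s s0|_]; last by rewrite leey.
  by rewrite lee_fin opprD addNKr normrN ger0_norm.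
rewrite Lnorm1; apply: (@le_trans _ _ (\int[m]_x r x)%E).
  apply: ge0_le_integral => //; last by move=> x _; exact: le_r.
  apply: measurableT_comp => //; apply/measurable_EFinP.
  by apply: measurable_funB => //; exact: measurable_sum.
rewrite [leLHS](_ : _ =
    (\sum_(0 <= k <oo) \int[m]_x (u (k + n)%N x)%:E)%E); last first.
  by apply: (@integral_nneseries _ _ _ m _ measurableT (fun k => EFin \o u (k + n)%N)).
apply: lime_le.
  by apply: is_cvg_nneseries => k _ _; apply: integral_ge0 => x _; rewrite lee_fin.
apply: nearW => N.
apply: (@le_trans _ _ (\sum_(0 <= k < N) (8^-1 ^+ (k + n))%:E)%E).
  apply: lee_sum => k _; apply: le_trans (normu (k + n)%N); rewrite Lnorm1.
  apply: ge0_le_integral => //.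
  - by move=> x _; exact: U0.
  - exact: mU.
  - by apply: measurableT_comp => //; exact: mU.
  - by move=> x _; exact: lee_abs.
rewrite sumEFin lee_fin (le_trans _ (geometric8_le n (N + n)))//.
by rewrite -{2}[n]add0n big_addn addnK.
Qed.

(** A quantitative uniform boundedness principle: if each [T n] has norm at most
    [K n] and [g n] realizes at least 3/4 of it, then a single [f] has
    [`|T n f| >= K n * 8 ^- n.+1] for all [n].  Of the partial sums [s n] and
    [s n + 8 ^- n g n], one has an image under [T n] of norm at least half that
    of [T n (8 ^- n g n)], that is [3/8 K n * 8 ^- n]; it is chosen as [s n.+1].
    The later terms have total norm at most [8 ^- n / 7], hence they change the
    image by at most [1/7 K n * 8 ^- n], and [3/8 - 1/7 >= 1/8]. *)
Lemma gliding_hump (T : nat -> (X -> R) -> X -> R) (K : nat -> R)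
    (g : nat -> X -> R) :
  (forall n a b f h x, T n (fun y => a * f y + b * h y) x =
     a * T n f x + b * T n h x) ->
  (forall n f, measurable_fun setT f -> measurable_fun setT (T n f)) ->
  (forall n, 0 <= K n) ->
  (forall n f, measurable_fun setT f ->
     (norm1 (T n f) <= (K n)%:E * norm1 f)%E) ->
  (forall n x, 0 <= g n x) ->
  (forall n, measurable_fun setT (g n)) ->
  (forall n, norm1 (g n) = 1%E) ->
  (forall n, ((3 / 4 * K n)%:E <= norm1 (T n (g n)))%E) ->
  exists f : X -> R, m.-integrable setT (EFin \o f) /\
    forall n, ((K n * 8^-1 ^+ n.+1)%:E <= norm1 (T n f))%E.
Proof.
move=> Tlin mT K0 TK g0 mg g1 Tg.
pose large n h := ((3 / 8 * (K n * 8^-1 ^+ n))%:E <= norm1 (T n h))%E.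
pose e n h : R := (~~ large n h)%:R.
pose s := fix s n : X -> R :=
  if n is n'.+1 then fun x => s n' x + e n' (s n') * 8^-1 ^+ n' * g n' x
  else fun=> 0.
pose u n x := e n (s n) * 8^-1 ^+ n * g n x.
have sE n x : s n x = \sum_(0 <= k < n) u k x.
  by elim: n => [|n IH] /=; [rewrite big_geq|rewrite big_nat_recr//= IH].
have w0 k : 0 <= e k (s k) * 8^-1 ^+ k :> R.
  by rewrite mulr_ge0.
have mu k : measurable_fun setT (u k).
  by apply: measurable_funM => //; exact: measurable_cst.
have [f [mf fE]] : exists f : X -> R, measurable_fun setT f /\
    forall n, (norm1 (fun x => (\sum_(0 <= k < n) u k x - f x)%R)
               <= (8 / 7 * 8^-1 ^+ n)%:E)%E.
  apply: L1_series_remainder => // k => [x|].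
    exact: mulr_ge0.
  rewrite Lnorm1Z// g1 mule1 lee_fin ger0_norm//.
  by rewrite ler_piMl// /e; case: (large _ _).
have ms n : measurable_fun setT (s n).
  by rewrite (funext (sE n)); exact: measurable_sum.
exists f; split=> [|n].
  apply/integrableP; split; first exact/measurable_EFinP.
  rewrite -Lnorm1 (le_lt_trans _ (ltry (8 / 7 * 8^-1 ^+ 0)))//.
  apply: le_trans (fE 0); rewrite !Lnorm1 le_eqVlt; apply/orP; left; apply/eqP.
  by apply: eq_integral => x _ /=; rewrite big_geq// sub0r normrN.
have lins (a b : R) (h1 h2 : X -> R) :
    T n (fun x => a * h1 x + b * h2 x) = fun x => a * T n h1 x + b * T n h2 x.
  by apply/funext => x; exact: Tlin.
have An : 0 <= K n * 8^-1 ^+ n by rewrite mulr_ge0.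
have hump : ((3 / 8 * (K n * 8^-1 ^+ n))%:E <= norm1 (T n (s n.+1)))%E.
  have [bn|nbn] := boolP (large n (s n)).
    rewrite [X in T n X](_ : _ = s n)//; apply/funext => x /=.
    by rewrite /e bn !mul0r addr0.
  have gE : T n (g n) = fun x =>
      8 ^+ n * T n (s n.+1) x + (- 8 ^+ n) * T n (s n) x.
    rewrite -lins; congr (T n _); apply/funext => x /=.
    rewrite /e nbn mul1r mulrDr mulNr addrAC subrr add0r mulrA -exprMn.
    by rewrite mulfV// expr1n mul1r.
  have := Tg n; rewrite {}gE => /le_trans/(_ (Lnorm1D _ _ _)).
  have m1 := mT n _ (ms n.+1); have m2 := mT n _ (ms n).
  move=> /(_ (measurable_funM (measurable_cst _) m1)
             (measurable_funM (measurable_cst _) m2)).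
  rewrite !Lnorm1Z// normrN ger0_norm ?exprn_ge0//.
  move: nbn; rewrite /large -ltNge.
  case: (norm1 (T n (s n))) (Lnorm_ge0 m 1 (EFin \o T n (s n))) => //= a _.
  case: (norm1 (T n (s n.+1))) (Lnorm_ge0 m 1 (EFin \o T n (s n.+1))) => //= [b _|_ _ _].
    rewrite lte_fin -!EFinM -EFinD !lee_fin => ha hb.
    have p0 : 0 < (8 ^+ n : R) by rewrite exprn_gt0.
    have KE : K n = 8 ^+ n * (K n * 8^-1 ^+ n).
      by rewrite mulrCA -exprMn mulfV// expr1n mulr1.
    by move: hb; rewrite {1}KE -mulrDr mulrCA ler_pM2l//; lra.
  by rewrite leey.
have rem : (norm1 (T n (fun x => (s n.+1 x - f x)%R)) <=
    (K n * (8 / 7 * 8^-1 ^+ n.+1))%:E)%E.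
  apply: le_trans (TK _ _ _) _; first exact: measurable_funB.
  rewrite EFinM; apply: lee_wpmul2l; first by rewrite lee_fin.
  by rewrite (funext (sE _)); exact: fE.
have split_s : T n (s n.+1) = fun x => T n f x + T n (fun x => s n.+1 x - f x) x.
  rewrite [in LHS](_ : s n.+1 = fun x => 1 * f x + 1 * (s n.+1 x - f x)).
    by rewrite lins; apply/funext => x; rewrite !mul1r.
  by apply/funext => x; rewrite !mul1r addrC subrK.
move: hump; rewrite split_s => /le_trans/(_ (Lnorm1D _ _ _)).
have mdiff : measurable_fun setT (fun x => s n.+1 x - f x) by exact: measurable_funB.
move=> /(_ (mT n _ mf) (mT n _ mdiff)) /le_trans/(_ (leeD2l _ rem)).
case: (norm1 (T n f)) (Lnorm_ge0 m 1 (EFin \o T n f)) => //= [a _|_ _].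
  rewrite -EFinD !lee_fin exprS; move: An; set A := _ ^+ n; nra.
by rewrite leey.
Qed.

End GlidingHump.

(** * Lacunary subsequences and divergence *)

Lemma lacunary_subsequence (n : nat -> nat) :
  (forall k, (1 <= k)%N -> (0 < n k)%N) -> n k @[k --> \oo] --> \oo ->
  exists k : nat -> nat, [/\ (0 < k 0)%N, (forall i, (k i < k i.+1)%N),
    (forall i, (0 < n (k i))%N) & forall i, (8 * n (k i) <= n (k i.+1))%N].
Proof.
move=> n_gt0 /cvgnyPge n_oo.
have /choice[next nextP] a : exists b, (a < b)%N /\ (8 * n a <= n b)%N.
  have [K _ KP] := n_oo (8 * n a)%N.
  by exists (maxn a.+1 K); rewrite leq_maxl; split=> //; apply: KP; exact: leq_maxr.
have kS i : (iter i next 1 < iter i.+1 next 1)%N.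
  by have [] := nextP (iter i next 1%N).
exists (fun i => iter i next 1%N); split=> // i; last first.
  by have [] := nextP (iter i next 1%N).
by apply: n_gt0; elim: i => // i IH; exact: leq_trans IH (ltnW (kS i)).
Qed.

(* Scalars are real; since sums with real coefficients are a subfamily of those
   with complex coefficients, the complex version follows.  The value n 0 plays
   no role: the sequence is indexed from 1. *)
Theorem theorem2p17 (d : measure_display) (X : measurableType d) (R : realType)
    (m : probability X R) (tau : X -> X) (n : nat -> nat)
    (m_na : non_atomic m) (tau_mp : measure_preserving m tau)
    (tau_erg : ergodic m tau)
    (n_gt0 : forall k : nat, (1 <= k)%N -> (0 < n k)%N)
    (n_oo : n k @[k --> \oo] --> \oo) :
  exists f : X -> R, m.-integrable [set: X] (EFin \o f) /\
    ereal_sup [set ereal_sup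
      [set Lnorm m 1%E (fun x => (\sum_(1 <= k < M.+1)
                          c k * (erg_avg tau (n k.+1) f x - erg_avg tau (n k) f x))%:E)
       | c in [set c : nat -> R | forall k : nat, (1 <= k)%N -> `|c k| <= 1]]
     | M in [set M : nat | (1 <= M)%N]] = +oo%E.
Proof.
have [k [k0 kS Npos N8]] := lacunary_subsequence n_gt0 n_oo.
pose N i := n (k i); pose I j := (16 ^ j)%N.
have leN i i' : (i <= i')%N -> (N i <= N i')%N.
  move=> ii'; rewrite -(subnKC ii'); elim: (i' - i)%N => [|l IH].
    by rewrite addn0.
  by rewrite addnS (leq_trans IH)// (leq_trans _ (N8 _))// leq_pmull.
have /choice[A AP] j : exists A, [/\ measurable A, (0 < m A)%E & forall x i,
    A x -> (0 < i <= N (I j).*2)%N -> ~ A (iter i tau x)].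
  exact: ergodic_tower.
have [f [intf fE]] : exists f : X -> R, m.-integrable setT (EFin \o f) /\
    forall j, ((2 * (I j)%:R * 8^-1 ^+ j.+1)%:E <=
               'N[m]_1[EFin \o block_sum tau N (I j) f])%E.
  apply: (gliding_hump (g := fun j => bump m (A j))).
  - by move=> j a b f h x; exact: block_sum_lin.
  - by move=> j f; exact: (measurable_block_sum tau_mp).
  - by move=> j; rewrite mulr_ge0.
  - by move=> j f; exact: (Lnorm1_block_sum tau_mp).
  - by move=> j x; rewrite mulr_ge0 ?invr_ge0 ?fine_ge0.
  - by move=> j; apply: measurable_bump; have [] := AP j.
  - by move=> j; have [mA A0 _] := AP j; exact: Lnorm1_bump.
  - move=> j; have [mA A0 tower] := AP j.
    rewrite (_ : 3 / 4 * _ = 3 / 2 * (I j)%:R); last by field.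
    apply: (Lnorm1_block_sum_bump tau_mp mA A0 tower).
    + exact: Npos.
    + exact: N8.
    + by move=> i /ltnW; exact: leN.
exists f; split=> //; apply/eqyP => r r0.
(* The lower bound for index [j] equals [2 ^ j / 4]. *)
pose j := Num.truncn (4 * r).
have rj : (r%:E <= (2 * (I j)%:R * 8^-1 ^+ j.+1)%:E)%E.
  have -> : 2 * (I j)%:R * 8^-1 ^+ j.+1 = (2 ^ j)%:R / 4 :> R.
    rewrite /I (_ : 16 = 2 * 8)%N// expnMn natrM exprS !natrX exprVn.
    by field; rewrite expf_neq0.
  rewrite lee_fin ler_pdivlMr// mulrC; apply/ltW.
  by rewrite (lt_le_trans (truncnS_gt _))// ler_nat ltn_expl.
apply: le_trans rj _; apply: le_trans (fE j) _.
have [c [c1 cE]] := block_selection R (I j) k0 kS.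
pose M := (k (I j).*2).-1.
have k_gt i : (i < k i)%N by elim: i => // i IH; exact: leq_ltn_trans IH (kS i).
have M1 : (1 <= M)%N.
  rewrite -ltnS prednK; last exact: leq_ltn_trans (k_gt _).
  by apply: leq_ltn_trans (k_gt _); rewrite -muln2 muln_gt0 expn_gt0.
apply: le_trans (ereal_sup_ubound _); last by exists M.
apply: ereal_sup_ubound; exists c => //=.
congr (Lnorm m 1 _); apply/funext => x /=; congr EFin.
rewrite prednK; last exact: leq_ltn_trans (k_gt _).
exact: (cE (fun l => erg_avg tau (n l) f x)).
Qed.
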